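(* Let $(\mathcal{X},d)$ be a finite metric space. Then $(\mathcal{X},d)$ satisfies the Strong-four-point-condition if and only if $(\mathcal{X},d)$ can be isometrically embedded in a caterpillar.
   Context: Four-point-condition: a metric $d$ on $\mathcal{X}$ satisfies it if for all $\{x,y,u,v\}\subseteq\mathcal{X}$, $$d(x,y)+d(u,v)\le\max\{d(x,u)+d(y,v),\ d(x,v)+d(y,u)\}.$$ Strong-four-point-condition: a finite metric space $(\mathcal{X},d)$ satisfies it if $d$ satisfies the Four-point-condition and there exists a total order $\pi$ of $\mathcal{X}$ such that for all four distinct elements $i<_\pi j<_\pi k<_\pi l$ of $\mathcal{X}$, $$d(i,j)+d(k,l)\le d(i,k)+d(j,l)=d(i,l)+d(j,k).$$ Caterpillar: a caterpillar graph is a finite tree (a single vertex is allowed) such that deleting all its leaves leaves a path (possibly empty or a single vertex). A caterpillar means a caterpillar graph with positive edge lengths, viewed as a metric space on its vertex set with the (weighted) path metric. An isometric embedding in a caterpillar is thus a distance-preserving map from $\mathcal{X}$ into the vertex set of such a weighted caterpillar graph. *)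

(* Defs.v *)
From mathcomp Require Import all_boot all_order all_algebra.
From mathcomp Require Import boolp classical_sets wochoice reals.

Set Implicit Arguments.
Unset Strict Implicit.
Unset Printing Implicit Defensive.

Import Order.TTheory GRing.Theory Num.Theory.

Local Open Scope ring_scope.

Definition metric (R : realType) (X : Type) (d : X -> X -> R) : Prop :=
  [/\ forall x y, 0 <= d x y,
      forall x y, d x y = 0 <-> x = y,
      forall x y, d x y = d y x &
      forall x y z, d x z <= d x y + d y z].

(* The four points need not be distinct. *)
Definition four_point_condition (R : realType) (X : Type) (d : X -> X -> R) :
    Prop :=
  forall x y u v : X,
    d x y + d u v <= Num.max (d x u + d y v) (d x v + d y u).

Definition strict (X : eqType) (le : rel X) : rel X :=
  [rel x y | (x != y) && le x y].

Definition strong_four_point_condition (R : realType) (X : finType)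
    (d : X -> X -> R) : Prop :=
  four_point_condition d /\
  exists2 le : rel X, total_order le &
    forall i j k l : X,
      strict le i j -> strict le j k -> strict le k l ->
      d i j + d k l <= d i k + d j l /\ d i k + d j l = d i l + d j k.

(* A simple graph on V is given by its adjacency relation; a (simple) cycle is a
   duplicate-free closed walk, and needs at least three vertices. *)
Definition tree (V : finType) (e : rel V) : Prop :=
  [/\ symmetric e, irreflexive e, (0 < #|V|)%N,
      forall x y, connect e x y &
      forall c : seq V, ucycle e c -> (size c < 3)%N].

Definition degree (V : finType) (e : rel V) (v : V) : nat := #|[pred u | e v u]|.

Definition leaf (V : finType) (e : rel V) : pred V :=
  [pred v | degree e v == 1%N].

(* The subgraph induced on A is a path, possibly with no vertex or a single one:
   its vertices can be listed so that adjacency means being consecutive. *)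
Definition induces_path (V : finType) (e : rel V) (A : pred V) : Prop :=
  exists p : seq V,
    [/\ uniq p, p =i A &
        {in p &, forall u v, e u v = (index v p == (index u p).+1)
                                     || (index u p == (index v p).+1)}].

Definition caterpillar_graph (V : finType) (e : rel V) : Prop :=
  tree e /\ induces_path e (predC (leaf e)).

(* The values of w outside the edges are irrelevant. *)
Definition edge_lengths (R : realType) (V : finType) (e : rel V)
    (w : V -> V -> R) : Prop :=
  forall u v, e u v -> 0 < w u v /\ w u v = w v u.

(* The walk visits x and then, in order, the vertices of p. *)
Definition walk_length (R : realType) (V : finType) (w : V -> V -> R)
    (x : V) (p : seq V) : R :=
  \sum_(l <- pairmap w x p) l.

Definition path_metric (R : realType) (V : finType) (e : rel V)
    (w : V -> V -> R) (x y : V) : R :=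
  inf [set walk_length w x p | p in [set p | path e x p /\ last x p = y]]%classic.

Definition isometric_embedding (R : realType) (X Y : Type)
    (dX : X -> X -> R) (dY : Y -> Y -> R) (f : X -> Y) : Prop :=
  forall x y, dY (f x) (f y) = dX x y.

Definition embeds_in_caterpillar (R : realType) (X : finType)
    (d : X -> X -> R) : Prop :=
  exists (V : finType) (e : rel V) (w : V -> V -> R) (f : X -> V),
    [/\ caterpillar_graph e, edge_lengths e w &
        isometric_embedding d (path_metric e w) f].

(* Main.v *)
(* Both conditions say that the points have coordinates (s x, h x), h x >= 0, with
   d x y = h x + h y + |s x - s y| for x <> y: s x is the position on the spine
   of a caterpillar of the point where x is attached, and h x the length of the
   edge leading to x (0 if x is on the spine).  Sorting by s gives the strong
   four-point condition.  Conversely, if o and m are the least and greatest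
   elements of the order, the Gromov products s x = (x|m)_o and h x = (o|m)_x
   are such coordinates: for o < x < y < m the condition says that
   d(o,x) + d(y,m) <= d(o,y) + d(x,m) = d(o,m) + d(x,y), i.e. that s x <= s y
   and d(x,y) = h x + h y + s y - s x.  A path metric with edge lengths read off
   from coordinates is given by the formula, which obeys the triangle inequality
   and is attained by the walk through the spine. *)
Require Import Defs.
From mathcomp Require Import all_boot all_order all_algebra.
From mathcomp Require Import classical_sets wochoice reals.
From mathcomp Require Import lra zify.

Set Implicit Arguments.
Unset Strict Implicit.
Unset Printing Implicit Defensive.

Import Order.TTheory GRing.Theory Num.Theory.

Local Open Scope ring_scope.

(** * Distances given by spine coordinates *)

(* Two distinct points with the same coordinates are at distance 2 h, not 0. *)
Definition cat_dist (R : realType) (V : eqType) (h s : V -> R) (u v : V) : R :=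
  if u == v then 0 else h u + h v + `|s u - s v|.

Lemma cat_distC (R : realType) (V : eqType) (h s : V -> R) u v :
  cat_dist h s u v = cat_dist h s v u.
Proof. by rewrite /cat_dist eq_sym distrC [h u + _]addrC. Qed.

Lemma cat_dist_ge0 (R : realType) (V : eqType) (h s : V -> R) u v :
  (forall y, 0 <= h y) -> 0 <= cat_dist h s u v.
Proof.
by move=> h_ge0; rewrite /cat_dist; case: eqP => // _; rewrite !addr_ge0.
Qed.

(** For distinct points the detour through [v] costs an extra [2 * h v] on top of the triangle
    inequality on the line. Coincidences are treated first, as [cat_dist] is defined by cases. *)
Lemma cat_dist_triangle (R : realType) (V : eqType) (h s : V -> R) u v x :
  (forall y, 0 <= h y) ->
  cat_dist h s u x <= cat_dist h s u v + cat_dist h s v x.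
Proof.
move=> h_ge0.
have [<-|neq_ux] := eqVneq u x.
  by rewrite {1}/cat_dist eqxx addr_ge0 ?cat_dist_ge0.
have [<-|neq_uv] := eqVneq u v; first by rewrite {2}/cat_dist eqxx add0r.
have [<-|neq_vx] := eqVneq v x; first by rewrite {3}/cat_dist eqxx addr0.
rewrite /cat_dist (negPf neq_ux) (negPf neq_uv) (negPf neq_vx).
by have := ler_distD (s v) (s u) (s x); have := h_ge0 v; lra.
Qed.

Definition caterpillar_coordinates (R : realType) (X : eqType)
    (d : X -> X -> R) : Prop :=
  exists h s : X -> R,
    (forall x, 0 <= h x) /\ forall x y, d x y = cat_dist h s x y.

(** * From the ordered condition to coordinates *)

Lemma total_order_min (X : finType) (le : rel X) (x0 : X) :
  total_order le -> exists x, forall y, le x y.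
Proof.
move=> [[[lexx le_tr] _] le_tot].
have [x _ le_x] := @extremumP _ _ le x0 xpredT id lexx le_tr le_tot isT.
by exists x => y; apply: le_x.
Qed.

Lemma total_order_dual (X : finType) (le : rel X) :
  total_order le -> total_order (fun x y => le y x).
Proof.
move=> [[[lexx le_tr] le_anti] le_tot]; split=> [|x y]; last by rewrite orbC.
split; first by split=> // y x z leyx lezy; apply: (le_tr y).
by move=> x y /andP[leyx lexy]; apply: le_anti; rewrite lexy.
Qed.

Lemma strict_trans (X : finType) (le : rel X) :
  total_order le -> forall x y z,
  strict le x y -> strict le y z -> strict le x z.
Proof.
move=> [[[_ le_tr] le_anti] _] x y z /andP[neq_xy lexy] /andP[_ leyz].
apply/andP; split; last exact: le_tr leyz.
by apply: contraNneq neq_xy => xz; rewrite (le_anti x y) // lexy xz.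
Qed.

Lemma strong_four_point_coordinates (R : realType) (X : finType)
    (d : X -> X -> R) :
  metric d -> strong_four_point_condition d -> caterpillar_coordinates d.
Proof.
move=> [d_ge0 d_eq0 dC d_tri] [_ [le le_order le_four]].
have [x0|X0] := pickP (fun _ : X => true); last first.
  by exists (fun=> 0), (fun=> 0); split=> // x; have := X0 x.
move=> _.
have [o le_o] := total_order_min x0 le_order.
have [m le_m] := total_order_min x0 (total_order_dual le_order).
have dxx x : d x x = 0 by apply/d_eq0.
exists (fun x => (d o x + d x m - d o m) / 2),
  (fun x => (d o x + d o m - d x m) / 2); split=> [x|].
  by have := d_tri o x m; lra.
suff ordered x y : le x y -> x != y ->
  d x y = cat_dist (fun x => (d o x + d x m - d o m) / 2)
                   (fun x => (d o x + d o m - d x m) / 2) x y.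
  move=> x y; have [->|neq_xy] := eqVneq x y.
    by rewrite /cat_dist eqxx dxx.
  have [_ le_tot] := le_order; have /orP[lexy|leyx] := le_tot x y.
    exact: ordered.
  by rewrite dC cat_distC ordered // eq_sym.
move=> lexy neq_xy.
(* For the chosen coordinates, [h y + s y = d o y] and [h x - s x = d x m - d o m]: the equality is
   the distance formula with [s y - s x], the inequality says that this difference is
   nonnegative. *)
suff [s_le dE] : d o x + d y m <= d o y + d x m /\
    d o y + d x m = d o m + d x y.
  rewrite /cat_dist (negPf neq_xy) distrC ger0_norm; lra.
have := d_tri o x y; have := d_tri x y m; have := d_tri o x m.
have := d_tri o y m; have := dC x o; have := dC m y.
(* The order condition speaks of four distinct points only. If [o = x] or [y = m], the equality is
   trivial and the inequality is a triangle inequality. *)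
have [ox|neq_ox] := eqVneq o x.
  by subst x; rewrite dxx => *; have := d_tri y o m; have := dC o y; split; lra.
have [ym|neq_ym] := eqVneq y m.
  by subst y; rewrite dxx => *; have := d_tri o m x; have := dC m x; split; lra.
move=> _ _ _ _ _ _.
by apply: le_four; rewrite /strict /= ?neq_ox ?neq_xy ?neq_ym /= ?le_o ?le_m.
Qed.

(** * From coordinates to the ordered condition *)

Lemma coordinates_strong_four_point (R : realType) (X : finType)
    (d : X -> X -> R) :
  metric d -> caterpillar_coordinates d -> strong_four_point_condition d.
Proof.
move=> [d_ge0 d_eq0 dC d_tri] [h [s [h_ge0 dE]]].
have dxx x : d x x = 0 by apply/d_eq0.
have dneq x y : x != y -> d x y = h x + h y + `|s x - s y|.
  by move=> neq_xy; rewrite dE /cat_dist (negPf neq_xy).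
split.
  move=> x y u v; rewrite le_max; apply/orP.
  (* If two points coincide, the claim is a triangle inequality or an equality up to symmetry. *)
  have [->|xy] := eqVneq x y.
    by left; rewrite dxx add0r [d y u]dC.
  have [->|uv] := eqVneq u v.
    by left; rewrite dxx addr0 [d y v]dC.
  have [->|xu] := eqVneq x u; first by right; rewrite addrC [d y u]dC.
  have [->|xv] := eqVneq x v.
    by left; rewrite [d u v]dC addrC [d y v]dC addrC.
  have [->|yu] := eqVneq y u; first by left.
  have [->|yv] := eqVneq y v; first by right; rewrite [d v u]dC.
  (* Each sum contains every [h] once, so these cancel and four points on a line remain. *)
  rewrite !dneq //; move: (s x) (s y) (s u) (s v) => a b c e.
  suff: `|a - b| + `|c - e| <= `|a - c| + `|b - e| \/
        `|a - b| + `|c - e| <= `|a - e| + `|b - c| by case; [left|right]; lra.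
  by case: (lerP a b); case: (lerP a c); case: (lerP a e); case: (lerP b c);
     case: (lerP b e); case: (lerP c e) => *; lra.
(* Ties in [s] are broken by [enum_rank], which makes [le] antisymmetric. *)
pose le x y := (s x < s y) || ((s x == s y) && (enum_rank x <= enum_rank y)%N).
have le_s x y : le x y -> s x <= s y.
  by rewrite /le le_eqVlt => /orP[->|/andP[->]]; rewrite ?orbT.
have le_order : total_order le.
  split=> [|x y]; last first.
    by rewrite /le; case: (ltgtP (s x) (s y)) => //= _; rewrite leq_total.
  split; first split.
  - by move=> x; rewrite /le eqxx leqnn orbT.
  - move=> y x z; rewrite /le.
    case: (ltgtP (s x) (s y)) => //= [sxy _|->].
      case: (ltgtP (s y) (s z)) => //= [syz|<-]; rewrite ?sxy //.
      by rewrite (lt_trans sxy).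
    by case: (ltgtP (s y) (s z)) => //= _; apply: leq_trans.
  - move=> x y; rewrite /le; case: (ltgtP (s x) (s y)) => //= _.
    by rewrite -eqn_leq => /eqP/val_inj/enum_rank_inj.
have le_strict := strict_trans le_order.
exists le => //.
move=> i j k l ij jk kl.
have ik := le_strict _ _ _ ij jk; have jl := le_strict _ _ _ jk kl.
have il := le_strict _ _ _ ij jl.
have strict_dE x y : strict le x y ->
    s x <= s y /\ d x y = h x + h y + (s y - s x).
  case/andP=> neq_xy /le_s les; split=> //.
  by rewrite dneq // distrC ger0_norm ?subr_ge0.
have [? ->] := strict_dE _ _ ij; have [? ->] := strict_dE _ _ kl.
have [_ ->] := strict_dE _ _ ik; have [_ ->] := strict_dE _ _ jl.
have [_ ->] := strict_dE _ _ il; have [? ->] := strict_dE _ _ jk.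
(* The two larger sums agree and exceed the first by [2 * (s k - s j)]. *)
by split; lra.
Qed.

(** * Cycles, walks and path metrics *)

(* A cycle would contain two distinct neighbours of its vertex of highest rank. *)
Lemma ranked_acyclic (V : finType) (e : rel V) (r : V -> nat) (c : seq V) :
  symmetric e ->
  (forall x y z, e x y -> e x z -> (r y <= r x)%N -> (r z <= r x)%N -> y = z) ->
  ucycle e c -> (size c < 3)%N.
Proof.
move=> e_sym r_inj /andP[cyc uniq_c]; rewrite ltnNge; apply/negP=> size_c.
have [a ac] : exists a, a \in c.
  by case: c size_c {cyc uniq_c} => // a c _; exists a; rewrite mem_head.
have [x xc r_max] := arg_maxnP r ac.
(* Once the cycle starts at [x], its second and last entries are neighbours of [x], distinct since
   there are at least three entries. *)
have [i c' c'E] := rot_to xc.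
move: cyc uniq_c size_c; rewrite -(rot_cycle i) -(rot_uniq i) -(size_rot i c) c'E.
have {}r_max y : y \in x :: c' -> (r y <= r x)%N.
  by rewrite -c'E mem_rot => /r_max.
case: c' c'E r_max => [|y c'] c'E r_max //.
case/lastP: c' c'E r_max => [|c' z] _ r_max //=.
rewrite rcons_path last_rcons => /and3P[exy _ ezx] /and3P[_ ync' _] _.
have := r_inj x y z; rewrite exy e_sym ezx !r_max ?inE ?mem_rcons ?inE ?eqxx ?orbT //.
by move=> /(_ isT isT isT isT) yz; rewrite yz mem_rcons mem_head in ync'.
Qed.

Definition walk (R : realType) (V : finType) (e : rel V) (w : V -> V -> R)
    (u v : V) (r : R) : Prop :=
  exists p, [/\ path e u p, last u p = v & walk_length w u p = r].

(** Summing triangle inequalities along a walk bounds its length below by [D]; a walk attaining the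
    bound makes it the infimum. *)
Lemma path_metric_eq (R : realType) (V : finType) (e : rel V)
    (w D : V -> V -> R) (u v : V) :
  (forall x, D x x = 0) -> (forall x y z, D x z <= D x y + D y z) ->
  (forall x y, e x y -> w x y = D x y) ->
  walk e w u v (D u v) ->
  path_metric e w u v = D u v.
Proof.
move=> Dxx D_tri wD [p [pP p_last p_len]].
have D_le q x : path e x q -> D x (last x q) <= walk_length w x q.
  elim: q x => [|y q IHq] x /=; rewrite /walk_length ?big_nil ?Dxx //=.
  case/andP=> exy /IHq; rewrite big_cons wD //.
  by have := D_tri x y (last y q); rewrite /walk_length; lra.
have D_lb : lbound [set walk_length w u q
    | q in [set q | path e u q /\ last u q = v]]%classic (D u v).
  by move=> _ [q [qP <-] <-]; apply: D_le.
apply/eqP; rewrite eq_le; apply/andP; split; last first.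
  by apply: lb_le_inf => //; exists (D u v), p.
by apply: ge_inf; [exists (D u v) | exists p].
Qed.

Lemma walk_refl (R : realType) (V : finType) (e : rel V) (w : V -> V -> R) u :
  walk e w u u 0.
Proof. by exists [::]; rewrite /walk_length big_nil. Qed.

Lemma walk_edge (R : realType) (V : finType) (e : rel V) (w : V -> V -> R) u v :
  e u v -> walk e w u v (w u v).
Proof. by move=> euv; exists [:: v]; rewrite /= euv /walk_length big_seq1. Qed.

Lemma walk_trans (R : realType) (V : finType) (e : rel V) (w : V -> V -> R)
    u v x a b :
  walk e w u v a -> walk e w v x b -> walk e w u x (a + b).
Proof.
move=> [p [pP p_last p_len]] [q [qP q_last q_len]]; exists (p ++ q).
rewrite cat_path last_cat /walk_length pairmap_cat big_cat /=.
by rewrite p_last pP qP q_last; split=> //; rewrite -p_len -q_len.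
Qed.

(** * Path metric of a graph with a spine *)

(* c 0, ..., c n.-1 is the spine, and v is c (k v) or hangs from it. *)
Section Spine.

Variables (R : realType) (V : finType) (e : rel V) (w : V -> V -> R).
Variables (n : nat) (c : nat -> V) (k : V -> nat) (h : V -> R) (t : nat -> R).

Let D := cat_dist h (t \o k).

Hypothesis e_sym : symmetric e.
Hypothesis e_irr : irreflexive e.
Hypothesis h_ge0 : forall v, 0 <= h v.
Hypothesis k_lt : forall v, (k v < n)%N.
Hypothesis cK : forall i, (i < n)%N -> k (c i) = i.
Hypothesis h_spine : forall i, (i < n)%N -> h (c i) = 0.
Hypothesis t_le : forall i, (i.+1 < n)%N -> t i <= t i.+1.
Hypothesis e_spine : forall i, (i.+1 < n)%N -> e (c i) (c i.+1).
Hypothesis e_base : forall v, v = c (k v) \/ e v (c (k v)).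
Hypothesis wD : forall u v, e u v -> w u v = D u v.

Lemma edge_neq u v : e u v -> u != v.
Proof. by apply: contraTneq => ->; rewrite e_irr. Qed.

Lemma edge_length u v : e u v -> w u v = h u + h v + `|t (k u) - t (k v)|.
Proof. by move=> euv; rewrite wD // /D /cat_dist (negPf (edge_neq euv)). Qed.

Lemma walk_base v : walk e w v (c (k v)) (h v) /\ walk e w (c (k v)) v (h v).
Proof.
have [vE|ev] := e_base v.
  by rewrite -vE [h v](congr1 h vE) h_spine //; split; apply: walk_refl.
have hE x y : e x y -> k x = k y -> w x y = h x + h y.
  by move=> exy kxy; rewrite edge_length // kxy subrr normr0 addr0.
have kE : k v = k (c (k v)) by rewrite cK.
have hv := h_spine (k_lt v).
split.
  by rewrite -[h v]addr0 -hv -hE //; apply: walk_edge.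
rewrite e_sym in ev.
by rewrite -[h v]add0r -hv -hE //; apply: walk_edge.
Qed.

Lemma walk_spine i j : (i <= j < n)%N ->
  walk e w (c i) (c j) (t j - t i) /\ walk e w (c j) (c i) (t j - t i).
Proof.
case/andP; elim: j => [|j IHj].
  by rewrite leqn0 => /eqP-> _; rewrite subrr; split; apply: walk_refl.
rewrite leq_eqVlt => /predU1P[-> _|].
  by rewrite subrr; split; apply: walk_refl.
rewrite ltnS => le_ij lt_jn; have lt_jn' := ltnW lt_jn.
have [w1 w2] := IHj le_ij lt_jn'; have ej := e_spine lt_jn.
have t_j := t_le lt_jn.
have := edge_length ej; rewrite !cK // !h_spine // distrC ger0_norm ?subr_ge0 // => wj.
have ej' := ej; rewrite e_sym in ej'.
have := edge_length ej'; rewrite !cK // !h_spine // ger0_norm ?subr_ge0 // => wj'.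
split.
  have -> : t j.+1 - t i = (t j - t i) + w (c j) (c j.+1) by rewrite wj; lra.
  exact: walk_trans w1 (walk_edge _ _).
have -> : t j.+1 - t i = w (c j.+1) (c j) + (t j - t i) by rewrite wj'; lra.
exact: walk_trans (walk_edge _ _) w2.
Qed.

Lemma t_mono i j : (i <= j < n)%N -> t i <= t j.
Proof.
case/andP; elim: j => [|j IHj]; first by rewrite leqn0 => /eqP->.
rewrite leq_eqVlt => /predU1P[-> //|]; rewrite ltnS => le_ij lt_jn.
exact: le_trans (IHj le_ij (ltnW lt_jn)) (t_le lt_jn).
Qed.

(** For [u] other than [v], the walk goes from [u] to its base, along the spine, and out to [v]. *)
Lemma spine_geodesic u v : walk e w u v (D u v).
Proof.
rewrite /D /cat_dist; case: eqP => [->|_]; first exact: walk_refl.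
have -> : h u + h v + `|(t \o k) u - (t \o k) v| =
  h u + (`|t (k u) - t (k v)| + h v) by rewrite /= addrAC addrA.
have [w1 _] := walk_base u; have [_ w2] := walk_base v.
apply: walk_trans w1 (walk_trans _ w2).
case/orP: (leq_total (k u) (k v)) => le_k.
  have kP : (k u <= k v < n)%N by rewrite le_k k_lt.
  by rewrite distrC ger0_norm ?subr_ge0 ?t_mono //; have [] := walk_spine kP.
have kP : (k v <= k u < n)%N by rewrite le_k k_lt.
by rewrite ger0_norm ?subr_ge0 ?t_mono //; have [] := walk_spine kP.
Qed.

Lemma spine_path_metric u v : path_metric e w u v = D u v.
Proof.
apply: path_metric_eq => //; first by move=> x; rewrite /D /cat_dist eqxx.
  by move=> x y z; apply: cat_dist_triangle.
exact: spine_geodesic.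
Qed.

Lemma spine_connect u v : connect e u v.
Proof.
by have [p [pP <- _]] := spine_geodesic u v; apply/connectP; exists p.
Qed.

End Spine.

(** * Combs realising given coordinates *)

(* Vertex (i, None) is on the spine and (i, Some x) hangs from it.  As soon as T
   has two elements every spine vertex has degree at least 2, so that the leaves
   are exactly the hanging vertices. *)
Definition comb (m : nat) (T : finType) : rel ('I_m * option T) :=
  fun u v => match u, v with
    | (i, None), (j, None) => (j == i.+1 :> nat) || (i == j.+1 :> nat)
    | (i, None), (j, Some _) | (i, Some _), (j, None) => i == j
    | _, _ => false
    end.

Arguments comb : clear implicits.

Lemma comb_sym m (T : finType) : symmetric (comb m T).
Proof. by move=> [i [x|]] [j [y|]] //=; rewrite orbC. Qed.

Lemma comb_irr m (T : finType) : irreflexive (comb m T).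
Proof. by move=> [i [x|]] //=; apply/negbTE; lia. Qed.

Lemma comb_acyclic m (T : finType) c : ucycle (comb m T) c -> (size c < 3)%N.
Proof.
(* Hanging vertices rank above the whole spine, so a spine vertex has at most its predecessor as a
   neighbour of no larger rank, and a hanging vertex has only its base. *)
pose r (v : 'I_m * option T) := if v.2 is Some _ then m else v.1 : nat.
apply: (ranked_acyclic (r := r)); first exact: comb_sym.
move=> [i [x|]] [j [y|]] [l [z|]] //=; rewrite /r /=.
- by move=> /eqP-> /eqP->.
- by have := ltn_ord i; lia.
- by have := ltn_ord i; lia.
- by have := ltn_ord i; lia.
by move=> *; congr (_, _); apply: ord_inj; lia.
Qed.

Lemma comb_induces_path m (T : finType) : (1 < #|T|)%N ->
  induces_path (comb m T) (predC (leaf (comb m T))).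
Proof.
move=> T_gt1; pose g (i : 'I_m) : 'I_m * option T := (i, None).
have g_inj : injective g by move=> i j [].
exists [seq g i | i <- enum 'I_m]; split.
- by rewrite map_inj_uniq ?enum_uniq.
- move=> [i [x|]]; rewrite !inE /leaf /=.
    have -> : degree (comb m T) (i, Some x) = 1%N.
      apply: (@eq_card1 _ (i, None)) => -[j [y|]]; rewrite !inE ?xpair_eqE ?andbF //=.
      by rewrite andbT eq_sym.
    by apply/negP => /mapP[].
  rewrite map_f ?mem_enum //; apply/esym; rewrite neq_ltn; apply/orP; right.
  have q_inj : injective (fun x : T => (i, Some x)) by move=> x y [].
  apply: leq_trans T_gt1 _; rewrite -(card_imset _ q_inj).
  apply: subset_leq_card; apply/fintype.subsetP => _ /imsetP[x _ ->].
  by rewrite inE /=.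
move=> _ _ /mapP[i _ ->] /mapP[j _ ->].
by rewrite !(index_map g_inj) !index_enum_ord.
Qed.

Section WeightedComb.

Variables (R : realType) (m : nat) (T : finType).
Variables (h : 'I_m.+1 * option T -> R) (t : nat -> R).

Hypothesis T_gt1 : (1 < #|T|)%N.
Hypothesis h_spine : forall i, h (i, None) = 0.
Hypothesis h_gt0 : forall i x, 0 < h (i, Some x).
Hypothesis t_lt : forall i j, (i < j < m.+1)%N -> t i < t j.

Let k (v : 'I_m.+1 * option T) : nat := v.1.
Let w := cat_dist h (t \o k).

Let h_ge0 v : 0 <= h v.
Proof. by case: v => i [x|]; rewrite ?h_spine // ltW. Qed.

Let c (i : nat) : 'I_m.+1 * option T := (inord i, None).

Let k_lt v : (k v < m.+1)%N. Proof. exact: ltn_ord. Qed.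
Let cK i : (i < m.+1)%N -> k (c i) = i. Proof. exact: inordK. Qed.
Let t_le i : (i.+1 < m.+1)%N -> t i <= t i.+1.
Proof. by move=> lt_im; rewrite ltW // t_lt ?ltnSn. Qed.
Let e_spine i : (i.+1 < m.+1)%N -> comb _ T (c i) (c i.+1).
Proof. by move=> lt_im; rewrite /= !inordK ?eqxx // ltnW. Qed.
Let e_base v : v = c (k v) \/ comb _ T v (c (k v)).
Proof. by case: v => i [x|] /=; rewrite /c /k inord_val; [right|left]. Qed.

Let h_base i : (i < m.+1)%N -> h (c i) = 0. Proof. by rewrite h_spine. Qed.

Lemma comb_path_metric u v : path_metric (comb m.+1 T) w u v = w u v.
Proof.
apply: (@spine_path_metric R _ _ _ m.+1 c k h t) => //; first exact: comb_sym.
exact: comb_irr.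
Qed.

Lemma comb_caterpillar : caterpillar_graph (comb m.+1 T).
Proof.
split; last exact: comb_induces_path.
split.
- exact: comb_sym.
- exact: comb_irr.
- by apply/card_gt0P; exists (ord0, None).
- apply: (@spine_connect R _ _ w m.+1 c k h t) => //; first exact: comb_sym.
  exact: comb_irr.
- exact: comb_acyclic.
Qed.

Lemma comb_edge_lengths : edge_lengths (comb m.+1 T) w.
Proof.
move=> u v euv; split; last exact: cat_distC.
have neq_uv : u != v by apply: contraTneq euv => ->; rewrite comb_irr.
rewrite /w /cat_dist (negPf neq_uv).
case: u v euv {neq_uv} => [i [x|]] [j [y|]] //=.
- by move=> _; rewrite h_spine addr0 ltr_wpDr.
- by move=> _; rewrite h_spine add0r ltr_wpDr.
rewrite !h_spine !add0r normr_gt0 subr_eq0 /k /=.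
by case/orP=> /eqP ij; have := ltn_ord i; have := ltn_ord j => jm im;
  [rewrite lt_eqF|rewrite gt_eqF] => //; apply: t_lt; rewrite ij ?leqnn //= -ij.
Qed.

End WeightedComb.

Lemma coordinates_embed (R : realType) (X : finType) (d : X -> X -> R) :
  metric d -> caterpillar_coordinates d -> embeds_in_caterpillar d.
Proof.
move=> [_ d_eq0 _ _] [h [s [h_ge0 dE]]].
(* 0 is added because the comb must have a vertex even if X is empty. *)
pose ts := sort <=%O (undup (0 :: map s (enum X))).
have ts_sorted : sorted <%O ts by rewrite sort_lt_sorted undup_uniq.
have s_ts x : s x \in ts by rewrite mem_sort mem_undup inE map_f ?orbT ?mem_enum.
have [m tsE] : exists m, size ts = m.+1.
  have : 0 \in ts by rewrite mem_sort mem_undup mem_head.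
  by case: ts {ts_sorted s_ts} => // a l _; exists (size l).
have t_lt i j : (i < j < m.+1)%N -> nth 0 ts i < nth 0 ts j.
  by case/andP=> ij jm; rewrite lt_sorted_ltn_nth ?inE ?tsE // (ltn_trans ij).
(* The two extra labels ensure at least two hanging vertices at each spine vertex, even for empty
   [X]. *)
pose T := option (option X).
have T_gt1 : (1 < #|{: T}|)%N by rewrite !card_option.
(* The value [1] is arbitrary: vertices outside the image of [f] only need edges of positive
   length. *)
pose H (v : 'I_m.+1 * option T) : R := match v.2 with
  | None => 0
  | Some (Some (Some x)) => if 0 < h x then h x else 1
  | Some _ => 1
  end.
have H_gt0 i x : 0 < H (i, Some x).
  by case: x => [[x|]|] //; rewrite /H /=; case: ifP.
(* A point with [h x = 0] must lie on the spine, since an edge of length [0] is not allowed. *)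
pose f x : 'I_m.+1 * option T :=
  (inord (index (s x) ts), if 0 < h x then Some (Some (Some x)) else None).
have fs x : nth 0 ts (f x).1 = s x.
  by rewrite /= inordK ?nth_index // -tsE index_mem.
have fh x : H (f x) = h x.
  rewrite /H /=; case: ltP => [->//|hx].
  by apply/eqP; rewrite eq_le h_ge0.
exists _, (comb m.+1 T), (cat_dist H (nth 0 ts \o (fun v => nat_of_ord v.1))), f.
split.
- exact: (@comb_caterpillar _ _ _ H (nth 0 ts)).
- exact: comb_edge_lengths.
move=> x y; rewrite comb_path_metric //.
have [->|neq_xy] := eqVneq x y; first by rewrite dE /cat_dist !eqxx.
(* If [f x = f y], then either [h x] is positive and the label recovers [x], or [h x = 0] and the
   formula gives [d x y = 0]. *)
have neq_f : f x != f y.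
  apply: contraNneq neq_xy => fxy; apply/eqP/d_eq0.
  rewrite dE /cat_dist -!fh -!fs -fxy subrr normr0 addr0; case: eqP => // neq_xy.
  case: fxy => _; rewrite fh; case: ltP => // [_|hx]; first by case: ifP => // _ [].
  have -> : h x = 0 by apply/eqP; rewrite eq_le hx h_ge0.
  by rewrite addr0.
by rewrite dE /cat_dist (negPf neq_xy) (negPf neq_f) !fh /= !fs.
Qed.

(** * Coordinates on an arbitrary caterpillar *)

Lemma leafP (V : finType) (e : rel V) v :
  leaf e v -> exists u, e v u /\ forall x, e v x -> x = u.
Proof.
rewrite /leaf /= /degree => /eqP/mem_card1[u uP]; exists u.
have {}uP x : e v x = (x == u) by have := uP x; rewrite !inE.
by split=> [|x]; rewrite uP // => /eqP.
Qed.

(** A walk starting at one of the two leaves can only alternate between them, and by connectedness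
    walks from [u] reach every vertex. *)
Lemma adjacent_leaves (V : finType) (e : rel V) u v :
  symmetric e -> (forall x y, connect e x y) ->
  leaf e u -> leaf e v -> e u v -> forall x, x = u \/ x = v.
Proof.
move=> e_sym e_conn /leafP[u' [_ uP]] /leafP[v' [_ vP]] euv x.
have evu := euv; rewrite e_sym in evu.
have /connectP[q qP ->] := e_conn u x.
suff: forall y, y = u \/ y = v -> path e y q -> last y q = u \/ last y q = v.
  by move=> /(_ u (or_introl erefl) qP).
elim: q {qP} => //= z q IHq y yuv /andP[eyz]; apply: IHq.
case: yuv eyz => -> ez; [right|left].
  by rewrite (uP _ ez) (uP _ euv).
by rewrite (vP _ ez) (vP _ evu).
Qed.

(* The path of non-leaves, except that a caterpillar with leaves only is a single
   edge, of which either end can serve as the spine. *)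
Lemma caterpillar_spine (V : finType) (e : rel V) : caterpillar_graph e ->
  exists p : seq V,
    [/\ uniq p, (0 < size p)%N,
        {in p &, forall u v, e u v = (index v p == (index u p).+1)
                                     || (index u p == (index v p).+1)} &
        forall v, v \notin p ->
          exists2 u, u \in p & e v u /\ forall x, e v x -> x = u].
Proof.
move=> [[e_sym e_irr /card_gt0P[a _] e_conn _] [p [p_uniq pE p_edge]]].
have leafE v : leaf e v = (v \notin p) by rewrite pE inE negbK.
have [p0|p_gt0] := posnP (size p).
  have p_nil : p = [::] by apply: size0nil.
  have all_leaf v : leaf e v by rewrite leafE p_nil.
  exists [:: a]; split=> // [u v|v].
    by rewrite !inE => /eqP-> /eqP->; rewrite e_irr /= eqxx.
  rewrite inE => neq_va; have [u [evu uP]] := leafP (all_leaf v).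
  exists u => //; rewrite inE.
  have [av|->//] := adjacent_leaves e_sym e_conn (all_leaf v) (all_leaf u) evu a.
  by rewrite av eqxx in neq_va.
exists p; split=> // v vp.
have lv : leaf e v by rewrite leafE.
have [u [evu uP]] := leafP lv; exists u => //.
(* Were [u] a leaf too, [u] and [v] would be all the vertices, leaving none for [p]. *)
apply: contraLR p_gt0 => up; have lu : leaf e u by rewrite leafE.
case: p {p_uniq pE p_edge leafE} vp up => //= b p.
have [->|->] := adjacent_leaves e_sym e_conn lv lu evu b.
  by rewrite mem_head.
by move=> _; rewrite mem_head.
Qed.

Lemma caterpillar_metric (R : realType) (V : finType) (e : rel V)
    (w : V -> V -> R) :
  caterpillar_graph e -> edge_lengths e w ->
  exists h s : V -> R,
    (forall v, 0 <= h v) /\ forall u v, path_metric e w u v = cat_dist h s u v.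
Proof.
move=> e_cat w_gt0; have [[e_sym e_irr /card_gt0P[a _] e_conn _] _] := e_cat.
have [p [p_uniq p_gt0 p_edge p_leaf]] := caterpillar_spine e_cat.
(* [b v] is the base of [v]. Off the spine [v] has a neighbour, so the default of [odflt] is never
   reached. *)
pose b v := if v \in p then v else odflt v [pick u | e v u].
have bP v : v \notin p -> [/\ b v \in p, e v (b v) & forall x, e v x -> x = b v].
  move=> vp; have [u up [evu uP]] := p_leaf v vp; rewrite /b (negPf vp).
  by case: pickP => [x /[dup] evx /uP->|/(_ u)] //=; rewrite evu.
have bp v : b v \in p by have [vp|/bP[]//] := boolP (v \in p); rewrite /b vp.
pose c i := nth a p i; pose k v := index (b v) p.
pose h v : R := if v \in p then 0 else w v (b v).
(* The position of a spine vertex is its distance from the first one along the spine. *)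
pose t i : R := \sum_(0 <= j < i) w (c j) (c j.+1).
have k_lt v : (k v < size p)%N by rewrite index_mem.
have c_in i : (i < size p)%N -> c i \in p by apply: mem_nth.
have cK i : (i < size p)%N -> k (c i) = i.
  by move=> ip; rewrite /k /b c_in // index_uniq.
have kK v : c (k v) = b v by rewrite /c /k nth_index.
have h_ge0 v : 0 <= h v.
  by rewrite /h; case: ifPn => // /bP[_ /w_gt0[/ltW]].
have e_spine i : (i.+1 < size p)%N -> e (c i) (c i.+1).
  move=> ip; have ip' := ltnW ip.
  by rewrite p_edge ?c_in // !index_uniq // eqxx.
have t_step i : (i.+1 < size p)%N -> t i.+1 - t i = w (c i) (c i.+1).
  by move=> ip; rewrite /t big_nat_recr //= addrAC subrr add0r.
have t_le i : (i.+1 < size p)%N -> t i <= t i.+1.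
  move=> ip; rewrite -subr_ge0 t_step // ltW //.
  by have [] := w_gt0 _ _ (e_spine _ ip).
have wC u v : e u v -> w u v = w v u by move/w_gt0 => [].
have wD_next u v : u \in p -> v \in p -> e u v -> index v p = (index u p).+1 ->
    w u v = cat_dist h (t \o k) u v.
  move=> up vp euv iv.
  have neq_uv : u != v by apply: contraTneq euv => ->; rewrite e_irr.
  rewrite /cat_dist (negPf neq_uv) /h up vp !add0r distrC /= /k /b up vp iv.
  have ip : ((index u p).+1 < size p)%N by rewrite -iv index_mem.
  by rewrite ger0_norm ?subr_ge0 ?t_le // t_step // /c -iv !nth_index.
have wD_leaf u v : u \notin p -> e u v -> w u v = cat_dist h (t \o k) u v.
  move=> up euv; have [bup _ /(_ v euv) vE] := bP u up.
  have neq_uv : u != v by apply: contraTneq euv => ->; rewrite e_irr.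
  have vp : v \in p by rewrite vE.
  rewrite /cat_dist (negPf neq_uv) /h (negPf up) vp addr0 /= /k.
  have -> : b v = b u by rewrite /b vp -/(b u).
  by rewrite subrr normr0 addr0 -vE.
(* An edge joins consecutive spine vertices or has an end off the spine; the reversed orientations
   follow by symmetry. *)
have wD u v : e u v -> w u v = cat_dist h (t \o k) u v.
  move=> euv; have evu := euv; rewrite e_sym in evu.
  have [up|up] := boolP (u \in p); last exact: wD_leaf.
  have [vp|vp] := boolP (v \in p); last by rewrite wC // cat_distC wD_leaf.
  have := euv; rewrite p_edge // => /orP[]/eqP; first exact: wD_next.
  by rewrite wC // cat_distC; apply: wD_next.
exists h, (t \o k); split=> // u v.
apply: (@spine_path_metric R _ _ _ (size p) c k h t) => //.
  by move=> i ip; rewrite /h c_in.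
move=> x; rewrite kK; have [xp|xp] := boolP (x \in p).
  by left; rewrite /b xp.
by right; have [] := bP x xp.
Qed.

Lemma embed_coordinates (R : realType) (X : finType) (d : X -> X -> R) :
  metric d -> embeds_in_caterpillar d -> caterpillar_coordinates d.
Proof.
move=> [_ d_eq0 _ _] [V [e [w [f [e_cat w_gt0 f_iso]]]]].
have [h [s [h_ge0 wE]]] := caterpillar_metric e_cat w_gt0.
exists (h \o f), (s \o f); split=> [x|x y]; first exact: h_ge0.
rewrite -f_iso wE /cat_dist; have [->|neq_xy] := eqVneq x y; first by rewrite eqxx.
(* [cat_dist] tests equality in [V], so pulling it back along [f] uses that an isometry is
   injective. *)
case: eqVneq => // fxy; case/eqP: neq_xy.
by apply/d_eq0; rewrite -f_iso wE /cat_dist fxy eqxx.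
Qed.

Theorem theorem9 (R : realType) (X : finType) (d : X -> X -> R)
    (d_metric : metric d) :
  strong_four_point_condition d <-> embeds_in_caterpillar d.
Proof.
split=> [d_sfp|d_emb].
  exact/coordinates_embed/strong_four_point_coordinates.
exact/coordinates_strong_four_point/embed_coordinates.
Qed.
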